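(* Let $\mathbb{K}$ be a field of characteristic $0$ and $d\ge1$. If $f:\mathbb{K}^d\to\mathbb{K}$ belongs to a finite-dimensional $\mathbb{K}$-vector space $V$ of functions $\mathbb{K}^d\to\mathbb{K}$ such that $\tau_h(V)\subseteq V$ for all $h\in\mathbb{K}^d$ and $O_P(V)\subseteq V$ for all $P\in\mathrm{GL}(d,\mathbb{K})$, then $f$ is a polynomial; more precisely, $f=P(a_1(x),\dots,a_s(x))$ for some $P\in\mathbb{K}[x_1,\dots,x_s]$ and some additive functions $a_1,\dots,a_s:\mathbb{K}^d\to\mathbb{K}$.
   Context: For $g:\mathbb{K}^d\to\mathbb{K}$, $h\in\mathbb{K}^d$, $P\in\mathrm{GL}(d,\mathbb{K})$: $\tau_hg(x)=g(x+h)$ and $O_Pg(x)=g(Px)$. A function $a:\mathbb{K}^d\to\mathbb{K}$ is additive if $a(x+y)=a(x)+a(y)$ for all $x,y$. A (normal) polynomial $\mathbb{K}^d\to\mathbb{K}$ is an element of the $\mathbb{K}$-algebra of functions generated by the additive functions $\mathbb{K}^d\to\mathbb{K}$ and the constants. *)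

(* Defs.v *)
From HB Require Import structures.
From mathcomp Require Import all_boot all_order all_algebra.
From mathcomp Require Export mpoly.
Set Implicit Arguments. Unset Strict Implicit. Unset Printing Implicit Defensive.
Import GRing.Theory.
Local Open Scope ring_scope.

Definition tau (K : fieldType) (d : nat) (h : 'cV[K]_d) (g : 'cV[K]_d -> K) :
  'cV[K]_d -> K := fun x => g (x + h).

Definition OP (K : fieldType) (d : nat) (P : 'M[K]_d) (g : 'cV[K]_d -> K) :
  'cV[K]_d -> K := fun x => g (P *m x).

Definition additive_fun (K : fieldType) (d : nat) (a : 'cV[K]_d -> K) : Prop :=
  forall x y, a (x + y) = a x + a y.

(* The K-linear span of finitely many functions b_0, ..., b_{n-1};
   every finite-dimensional K-vector space of functions is of this form. *)
Definition in_span (K : fieldType) (d n : nat) (b : 'I_n -> ('cV[K]_d -> K))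
  (g : 'cV[K]_d -> K) : Prop :=
  exists c : 'I_n -> K, forall x, g x = \sum_(i < n) c i * b i x.

(* Main.v *)
Require Import Defs.
From HB Require Import structures.
From mathcomp Require Import all_boot all_order all_algebra.
From mathcomp Require Import mpoly.
From Stdlib Require Import Classical IndefiniteDescription.
Import GRing.Theory.
Local Open Scope ring_scope.

(** On a basis [B] of the invariant space, [B (x + h) = T h B x] with [T]
    a representation of the additive group. The scalar matrices [k], for [k] a
    positive integer, make [T (k h) = T h ^ k] conjugate to [T h], so all positive
    powers of [T h] have the same trace and those of [T h (T h - 1)] have trace [0];
    in characteristic [0] this forces [T h] to be unipotent. Then [T h ^ m] is a
    polynomial in [m], whose linear coefficient [A h], the logarithm of [T h], is
    additive in [h] and satisfies [T h = exp (A h)], a finite sum. Evaluating [f]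
    at [0 + h] expresses [f h] as a polynomial in the entries of [A h]. *)

(** * Trace criteria for nilpotent and unipotent matrices *)

(** In a rank factorization [E = C *m R] of an idempotent, [R *m C] is the identity of size
    [\rank E], and swapping the factors preserves the trace. *)
Lemma mxtrace_idempotent (K : fieldType) (n : nat) (E : 'M[K]_n) :
  E *m E = E -> \tr E = (\rank E)%:R.
Proof.
move=> idE; set C := col_base E; set R := row_base E.
have CR : C *m R = E by exact: mulmx_base.
have rfC : row_full C by exact: col_base_full.
have rfR : row_free R by exact: row_base_free.
have RC : R *m C = 1%:M.
  apply: (row_full_inj rfC); apply: (row_free_inj rfR).
  by rewrite mulmx1 mulmxA CR -mulmxA CR idE.
by rewrite -{1}CR mxtrace_mulC RC mxtrace1.
Qed.

Lemma mxtrace_horner_mx (K : fieldType) (n : nat) (A : 'M[K]_n.+1) (p : {poly K}) :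
  \tr (horner_mx A p) = \sum_(i < size p) p`_i * \tr (A ^+ i).
Proof.
rewrite -[p in LHS]coefK poly_def raddf_sum /= raddf_sum /=.
by apply: eq_bigr => i _; rewrite linearZ /= rmorphXn /= horner_mx_X mxtraceZ.
Qed.

(* The Fitting idempotent of [U] is a polynomial in [U] without constant term,
   so its trace, which is its rank, vanishes. *)
Lemma nilpotent_of_mxtrace (K : fieldType) (n : nat) (U : 'M[K]_n.+1) :
  [pchar K] =i pred0 -> (forall k, \tr (U ^+ k.+1) = 0) -> U ^+ n.+2 = 0.
Proof.
move=> /pcharf0P char0 trU.
have [m [q q0 chiE]] := multiplicity_XsubC (char_poly U) 0.
have chi_neq0 : char_poly U != 0 by apply: monic_neq0; exact: char_poly_monic.
rewrite chi_neq0 /= in q0; rewrite subr0 in chiE.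
have le_m : (m <= n.+1)%N.
  have q_neq0 : q != 0 by apply: contraNneq q0 => ->; rewrite root0.
  have := size_char_poly U; rewrite chiE size_mulXn // => sz.
  by rewrite -ltnS -sz -[X in (X < _)%N]addn0 ltn_add2l size_poly_gt0.
(* The exponent is [m.+1], not [m], so that [u * 'X^(m.+1)] has no constant term even when
   [m = 0]. *)
have cop : coprimep 'X^(m.+1) q.
  by apply: coprimep_expl; rewrite coprimep_sym -['X]subr0 coprimep_XsubC.
have /Bezout_eq1_coprimepP[[u v] /= uv] := cop.
pose E := horner_mx U (u * 'X^(m.+1)).
have qX : horner_mx U ('X^(m.+1) * q) = 0.
  by rewrite exprS -mulrA ['X^m * q]mulrC -chiE rmorphM /= Cayley_Hamilton mulr0.
have idE : E * E = E.
  apply/eqP; rewrite -subr_eq0 -{3}[E]mulr1 -mulrBr.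
  have -> : (1 : 'M[K]_n.+1) = horner_mx U 1 by rewrite rmorph1.
  rewrite -rmorphB -rmorphM /= -{1}uv opprD addrA subrr sub0r.
  have -> : u * 'X^(m.+1) * - (v * q) = - (u * v) * ('X^(m.+1) * q).
    by rewrite mulrN mulNr mulrACA.
  by rewrite rmorphM /= qX mulr0.
have trE : \tr E = 0.
  rewrite mxtrace_horner_mx big1 // => i _.
  rewrite coefMXn; case: ltnP => [_|]; first by rewrite mul0r.
  by case: (i : nat) => // k _; rewrite trU mulr0.
have E0 : E = 0.
  apply/eqP; rewrite -mxrank_eq0 -char0.
  by rewrite -(mxtrace_idempotent _ _ _ idE) trE.
(* Multiply the Bezout identity by ['X^(m.+1)] and evaluate at [U]: one term contains [E], the other
   ['X^(m.+1) * q]. *)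
have : U ^+ m.+1 = 0.
  have <- : horner_mx U 'X^(m.+1) = U ^+ m.+1 by rewrite rmorphXn /= horner_mx_X.
  rewrite -['X^(m.+1)]mul1r -uv mulrDl rmorphD /= rmorphM /= -/E E0 mul0r add0r.
  by rewrite -mulrA ['X^_ in LHS]lock mulrC -lock rmorphM /= [q * _]mulrC qX mul0r.
by move=> Um; rewrite -(subnK (_ : m.+1 <= n.+2)%N) // exprD Um mulr0.
Qed.

(** By linearity the trace of [T q(T)] is [\tr T * q(1)]. The choice [q = X^k (X - 1)^(k+1)] shows
    that [T (T - 1)] is nilpotent, and the unit [T] is then cancelled. *)
Lemma unipotent_of_mxtrace (K : fieldType) (n : nat) (T : 'M[K]_n.+1) :
    [pchar K] =i pred0 -> T \is a GRing.unit ->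
    (forall k, \tr (T ^+ k.+1) = \tr T) ->
  (T - 1) ^+ n.+2 = 0.
Proof.
move=> char0 unitT trT.
have trTq (q : {poly K}) : \tr (T * horner_mx T q) = \tr T * q.[1].
  have -> : T * horner_mx T q = horner_mx T ('X * q) by rewrite rmorphM /= horner_mx_X.
  rewrite -['X * q]coefK poly_def raddf_sum /= raddf_sum /=.
  rewrite (eq_bigr (fun i : 'I_(size ('X * q)) => \tr T * ('X * q)`_i)).
    rewrite -big_distrr /=; congr (_ * _).
    have -> : q.[1] = ('X * q).[1] by rewrite hornerM hornerX mul1r.
    by rewrite horner_coef; apply: eq_bigr => i _; rewrite expr1n mulr1.
  move=> i _; rewrite linearZ /= rmorphXn /= horner_mx_X mxtraceZ mulrC coefXM.
  by case: (i : nat) => [|k] /=; rewrite ?mulr0 ?mul0r // trT.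
have commTT1 : GRing.comm T (T - 1) by apply: commrB => //; exact: commr1.
have : (T * (T - 1)) ^+ n.+2 = 0.
  apply: nilpotent_of_mxtrace => // k.
  rewrite exprMn_comm // exprS -mulrA.
  have -> : T ^+ k * (T - 1) ^+ k.+1 = horner_mx T ('X^k * ('X - 1) ^+ k.+1).
    by rewrite rmorphM /= !rmorphXn /= rmorphB /= horner_mx_X rmorph1.
  by rewrite trTq hornerM !horner_exp hornerD hornerN hornerX hornerC subrr expr0n /= !mulr0.
rewrite exprMn_comm // => TT0.
by apply: (mulrI (unitrX n.+2 unitT)); rewrite mulr0.
Qed.

(** * Powers of a unipotent matrix, its logarithm and exponential *)

Lemma poly_eq_on_nat (K : fieldType) (p q : {poly K}) :
  [pchar K] =i pred0 -> (forall m : nat, p.[m%:R] = q.[m%:R]) -> p = q.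
Proof.
move=> /pcharf0P char0 pq; apply/eqP; rewrite -subr_eq0; apply/eqP.
apply: (@roots_geq_poly_eq0 _ _ [seq (m%:R : K) | m <- iota 0 (size (p - q))]).
- by apply/allP => _ /mapP[m _ ->]; rewrite rootE hornerD hornerN pq subrr.
- have natr_inj : injective (fun m : nat => m%:R : K).
    move=> a b /= /eqP; wlog le_ba : a b / (b <= a)%N => [H|].
      by case: (leqP b a) => [/H//|/ltnW /H{}H]; rewrite eq_sym => /H.
    by rewrite -subr_eq0 -natrB // char0 subn_eq0 => le_ab; apply/eqP; rewrite eqn_leq le_ab.
  by rewrite map_inj_uniq ?iota_uniq.
- by rewrite size_map size_iota.
Qed.

Definition binom_poly (K : fieldType) (j : nat) : {poly K} :=
  (j`!%:R)^-1 *: \prod_(i < j) ('X - (i%:R)%:P).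

Lemma size_binom_poly (K : fieldType) (j : nat) :
  (size (binom_poly K j) <= j.+1)%N.
Proof.
by rewrite (leq_trans (size_scale_leq _ _)) // size_prod_XsubC /index_enum -enumT size_enum_ord.
Qed.

Lemma horner_binom_poly (K : fieldType) (j m : nat) :
  [pchar K] =i pred0 -> (binom_poly K j).[m%:R] = 'C(m, j)%:R.
Proof.
move=> /pcharf0P char0; rewrite hornerZ.
have -> : (\prod_(i < j) ('X - (i%:R : K)%:P)).[m%:R] = (m ^_ j)%:R.
  elim: j => [|j IHj]; first by rewrite big_ord0 hornerC ffactn0.
  rewrite big_ord_recr /= hornerM IHj ffactnSr natrM hornerXsubC.
  by case: (leqP j m) => [/natrB-> // | lt_mj]; rewrite ffact_small // !mul0r.
by rewrite -bin_ffact natrM mulrC mulfK // char0 -lt0n fact_gt0.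
Qed.

(** In the binomial expansion of [(S + 1) ^+ m], nilpotency bounds the number of terms independently
    of [m], and each coefficient is polynomial in [m]. *)
Lemma unipotent_expr_poly (K : fieldType) (n N : nat) (S : 'M[K]_n.+1) :
    [pchar K] =i pred0 -> S ^+ N = 0 ->
  exists P : 'M[{poly K}]_n.+1,
    (forall i j, (size (P i j) <= N)%N) /\
    (forall m : nat, map_mx (horner_eval m%:R) P = (S + 1) ^+ m).
Proof.
move=> char0 SN.
exists (\matrix_(i, j) \sum_(k < N) (S ^+ k) i j *: binom_poly K k); split=> [i j|m].
  rewrite mxE; apply: leq_trans (size_sum _ _ _) _; apply/bigmax_leqP => k _.
  apply: leq_trans (size_scale_leq _ _) _.
  by apply: leq_trans (size_binom_poly _ _) _.
have -> : (S + 1) ^+ m = \sum_(k < N) S ^+ k *+ 'C(m, k).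
  rewrite exprD1n.
  (* Both sums extend to a common range: ['C(m, k)] vanishes for [k > m], and [S ^+ k] for
     [k >= N]. *)
  rewrite (big_ord_widen (maxn m.+1 N) (fun k => S ^+ k *+ 'C(m, k))) ?leq_maxl //.
  rewrite [RHS](big_ord_widen (maxn m.+1 N) (fun k => S ^+ k *+ 'C(m, k))) ?leq_maxr //.
  rewrite big_mkcond [RHS]big_mkcond; apply: eq_bigr => k _.
  case: (ltnP k N) => [_|le_Nk]; first by case: ltnP => // lt_mk; rewrite bin_small.
  case: ltnP => // _.
  by rewrite -(subnK le_Nk) exprD SN mulr0 mul0rn.
apply/matrixP => i j; rewrite !mxE /horner_eval horner_sum summxE.
apply: eq_bigr => k _.
by rewrite hornerZ horner_binom_poly // -[in RHS]scaler_nat mxE mulrC.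
Qed.

Lemma polymx_eq_on_nat (K : fieldType) (n : nat) (P Q : 'M[{poly K}]_n) :
    [pchar K] =i pred0 ->
    (forall m : nat, map_mx (horner_eval m%:R) P = map_mx (horner_eval m%:R) Q) ->
  P = Q.
Proof.
move=> char0 PQ; apply/matrixP => i j; apply: poly_eq_on_nat => // m.
by have /matrixP/(_ i j) := PQ m; rewrite !mxE.
Qed.

(** This is additivity of the logarithm on commuting matrices: [Q] is [P *m P'], and both factors
    have constant coefficient [1], seen at [m = 0]. *)
Lemma polymx_coef1_mul (K : fieldType) (n : nat) (T T' : 'M[K]_n.+1)
    (P P' Q : 'M[{poly K}]_n.+1) :
    [pchar K] =i pred0 -> GRing.comm T T' ->
    (forall m : nat, map_mx (horner_eval m%:R) P = T ^+ m) ->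
    (forall m : nat, map_mx (horner_eval m%:R) P' = T' ^+ m) ->
    (forall m : nat, map_mx (horner_eval m%:R) Q = (T * T') ^+ m) ->
  map_mx (coefp 1) Q = map_mx (coefp 1) P + map_mx (coefp 1) P'.
Proof.
move=> char0 TT' PT P'T' QT.
have -> : Q = P *m P'.
  by apply: polymx_eq_on_nat => // m; rewrite map_mxM QT PT P'T' exprMn_comm.
have coef0 (R : 'M[{poly K}]_n.+1) (S : 'M[K]_n.+1) i j :
    (forall m : nat, map_mx (horner_eval m%:R) R = S ^+ m) -> (R i j)`_0 = (i == j)%:R.
  by move=> /(_ 0%N)/matrixP/(_ i j); rewrite !mxE /horner_eval horner_coef0.
apply/matrixP => i j; rewrite !mxE /= coef_sum.
under eq_bigr => k _ do
  rewrite coefM 2!big_ord_recl big_ord0 addr0 /= (coef0 _ _ _ _ PT) (coef0 _ _ _ _ P'T').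
rewrite big_split /= (bigD1 i) //= eqxx mul1r big1 ?addr0; last first.
  by move=> k; rewrite eq_sym => /negbTE->; rewrite mul0r.
rewrite (bigD1 j) //= eqxx mulr1 big1 ?addr0 1?addrC //.
by move=> k /negbTE->; rewrite mulr0.
Qed.

(* [P] solves [P' = A P], [P 0 = 1], where [A] is the linear coefficient of [P]. *)
Lemma polymx_exp (K : fieldType) (n N : nat) (T : 'M[K]_n.+1)
    (P : 'M[{poly K}]_n.+1) :
    [pchar K] =i pred0 -> (forall i j, (size (P i j) <= N)%N) ->
    (forall m : nat, map_mx (horner_eval m%:R) P = T ^+ m) ->
  T = \sum_(r < N) (r`!%:R)^-1 *: map_mx (coefp 1) P ^+ r.
Proof.
move=> char0 szP PT; set A := map_mx (coefp 1) P.
have coef1E (p : {poly K}) : coefp 1 p = p^`().[0] by rewrite horner_coef0 coef_deriv.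
have shift m : map_mx (fun p => p \Po ('X + (m%:R)%:P)) P = P *m map_mx polyC (T ^+ m).
  apply: polymx_eq_on_nat => // k; rewrite map_mxM -[in RHS]map_mx_comp.
  rewrite (map_mx_id (f := horner_eval k%:R \o polyC)); last first.
    by move=> x; rewrite /= /horner_eval hornerC.
  rewrite PT -[RHS]exprD -PT; apply/matrixP => i j.
  by rewrite !mxE /horner_eval horner_comp hornerD hornerX hornerC -natrD.
(* The linear coefficients in [shift m] give [P'(m) = A T^m = A P(m)] for every natural [m]. *)
have ode : map_mx (@deriv K) P = map_mx polyC A *m P.
  apply: polymx_eq_on_nat => // m; rewrite map_mxM -[in RHS]map_mx_comp.
  rewrite (map_mx_id (f := horner_eval m%:R \o polyC)); last first.
    by move=> x; rewrite /= /horner_eval hornerC.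
  rewrite PT; apply/matrixP => i j.
  have /(congr1 (map_mx (coefp 1)))/matrixP/(_ i j) := shift m.
  rewrite !mxE coef1E deriv_comp derivD derivX derivC addr0 mulr1.
  rewrite horner_comp hornerD hornerX hornerC add0r /horner_eval => -> /=.
  by rewrite coef_sum; apply: eq_bigr => k _; rewrite !mxE coefMC.
(* The equation [ode] gives the recursion [(r + 1) P_(r+1) = A P_r] on coefficients. *)
have coefE r : map_mx (coefp r) P = (r`!%:R)^-1 *: A ^+ r.
  elim: r => [|r IHr].
    rewrite fact0 invr1 scale1r expr0 -(expr0 T) -PT.
    by apply/matrixP => i j; rewrite !mxE /horner_eval horner_coef0.
  have r1_neq0 : (r.+1%:R : K) != 0 by have /pcharf0P-> := char0.
  apply: (scalerI r1_neq0); rewrite factS natrM invfM !scalerA mulrA mulfV // mul1r.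
  rewrite exprS scalerAr -IHr; apply/matrixP => i j.
  have /(congr1 (map_mx (coefp r)))/matrixP/(_ i j) := ode.
  rewrite !mxE /= coef_deriv mulrC mulr_natr => ->.
  by rewrite coef_sum; apply: eq_bigr => k _; rewrite !mxE coefCM.
rewrite -[LHS]expr1 -PT; apply/matrixP => i j; rewrite !mxE summxE /horner_eval.
rewrite (horner_coef_wide _ (szP i j)); apply: eq_bigr => r _.
by rewrite -coefE !mxE /= expr1n mulr1.
Qed.

(** * Bases of function spaces and matrices of substitutions *)

Definition lin_indep {K : fieldType} {d n : nat} (b : 'I_n -> ('cV[K]_d -> K)) :=
  forall c : 'I_n -> K, (forall x, \sum_(i < n) c i * b i x = 0) -> forall i, c i = 0.

Lemma lin_indep_spanning (K : fieldType) (d n : nat) (b : 'I_n -> ('cV[K]_d -> K)) :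
  exists (m : nat) (b' : 'I_m -> ('cV[K]_d -> K)),
    lin_indep b' /\ (forall g, in_span b g <-> in_span b' g).
Proof.
elim: n b => [|n IHn] b; first by exists 0%N, b; split=> // c _ [].
case: (classic (lin_indep b)) => [|/not_all_ex_not[c]]; first by exists n.+1, b.
move=> c_dep; have [c_rel /not_all_ex_not[i /eqP ci_neq0]] := imply_to_and _ _ c_dep.
have [m [b' [indep span']]] := IHn (b \o lift i).
exists m, b'; split=> // g; rewrite -span'; split=> -[e gE]; last first.
  exists (fun j => if unlift i j is Some k then e k else 0) => x.
  rewrite gE (bigD1_ord i) //= unlift_none mul0r add0r.
  by apply: eq_bigr => j _; rewrite liftK.
exists (fun j => e (lift i j) - e i / c i * c (lift i j)) => x.
have := c_rel x; rewrite (bigD1_ord i) //= => /eqP; rewrite addr_eq0 => /eqP cb.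
rewrite gE (bigD1_ord i) //=.
have -> : e i * b i x = e i / c i * (c i * b i x) by rewrite mulrA divfK.
rewrite cb mulrN big_distrr /= addrC -sumrB.
by apply: eq_bigr => j _; rewrite mulrBl mulrA.
Qed.

Lemma mx_of_in_span (K : fieldType) (d n : nat) (b : 'I_n -> ('cV[K]_d -> K))
    (phi : 'cV[K]_d -> 'cV[K]_d) :
    (forall i, in_span b (b i \o phi)) ->
  exists T : 'M[K]_n, forall x, \col_i b i (phi x) = T *m \col_i b i x.
Proof.
move=> /functional_choice[c cE]; exists (\matrix_(i, j) c i j) => x.
apply/colP => i; rewrite !mxE [LHS]cE.
by apply: eq_bigr => j _; rewrite !mxE.
Qed.

(** Each row of [T - T'] is a linear relation among the [b i]. Identities between matrices can thus
    be checked on the substitutions they represent. *)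
Lemma lin_indep_mx_inj (K : fieldType) (d n : nat) (b : 'I_n -> ('cV[K]_d -> K))
    (T T' : 'M[K]_n) :
    lin_indep b -> (forall x, T *m \col_i b i x = T' *m \col_i b i x) -> T = T'.
Proof.
move=> indep TT'; apply/matrixP => i j; apply/eqP; rewrite -subr_eq0; apply/eqP.
apply: (indep (fun j => T i j - T' i j)) => x.
have /colP/(_ i) := TT' x; rewrite !mxE => /eqP; rewrite -subr_eq0 -sumrB => /eqP sum0.
by rewrite -[RHS]sum0; apply: eq_bigr => k _; rewrite !mxE mulrBl.
Qed.

Lemma translation_mx (K : fieldType) (d n : nat) (b : 'I_n.+1 -> ('cV[K]_d -> K)) :
    [pchar K] =i pred0 -> lin_indep b ->
    (forall h i, in_span b (tau h (b i))) ->
    (forall (P : 'M[K]_d) i, P \in unitmx -> in_span b (OP P (b i))) ->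
  exists T : 'cV[K]_d -> 'M[K]_n.+1,
    [/\ forall h x, \col_i b i (x + h) = T h *m \col_i b i x,
        forall h k, T (h + k) = T h * T k &
        forall h, (T h - 1) ^+ n.+2 = 0].
Proof.
move=> char0 indep tau_b OP_b.
have inj T T' := @lin_indep_mx_inj _ _ _ b T T' indep.
have /functional_choice[T TE] (h : 'cV[K]_d) := mx_of_in_span _ _ _ b (+%R^~ h) (tau_b h).
have TD h k : T (h + k) = T h * T k.
  apply: inj => x; rewrite -TE [h + k]addrC addrA TE TE.
  by rewrite mulmxA.
have T0 : T 0 = 1 by apply: inj => x; rewrite -TE addr0 mul1mx.
have unitT h : T h \is a GRing.unit.
  by apply/unitrP; exists (T (- h)); rewrite -!TD addNr subrr T0.
have TX h m : T (h *+ m) = T h ^+ m.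
  by elim: m => [|m IHm]; rewrite ?mulr0n // mulrS exprS TD IHm.
exists T; split=> // h; apply: unipotent_of_mxtrace => // k.
have k_neq0 : (k.+1%:R : K) != 0 by have /pcharf0P-> := char0.
have scale_b a : a != 0 -> forall i, in_span b (b i \o mulmx (a%:M : 'M[K]_d)).
  by move=> a_neq0 i; apply: OP_b; rewrite unitmxE det_scalar unitrX // unitfE.
have [Q QE] := mx_of_in_span _ _ _ b _ (scale_b _ k_neq0).
have [Q' Q'E] := mx_of_in_span _ _ _ b _ (scale_b _ (invr_neq0 k_neq0)).
have QQ' : Q * Q' = 1.
  by apply: inj => x; rewrite -mulmxA -Q'E -QE mulmxA -scalar_mxM mulfV // !mul1mx.
(* Both sides represent the substitution sending [x] to [(k + 1)(x + h) = (k + 1) x + (k + 1) h]. *)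
have QT : Q * T h = T h ^+ k.+1 * Q.
  apply: inj => x; rewrite -!mulmxA -TE -!QE mulmxDr -TX.
  by rewrite !mul_scalar_mx [_ *: h]scaler_nat TE.
have -> : T h ^+ k.+1 = Q * T h * Q' by rewrite QT -mulrA QQ' mulr1.
by rewrite mxtrace_mulC mulmxA (mulmx1C QQ') mul1mx.
Qed.

Theorem mainTheorem15 (K : fieldType) (d : nat) (n : nat)
  (b : 'I_n -> ('cV[K]_d -> K)) (f : 'cV[K]_d -> K) :
  [pchar K] =i pred0 ->
  (1 <= d)%N ->
  (forall h g, in_span b g -> in_span b (tau h g)) ->
  (forall (P : 'M[K]_d) g, P \in unitmx -> in_span b g -> in_span b (OP P g)) ->
  in_span b f ->
  exists (s : nat) (p : {mpoly K[s]}) (a : 'I_s -> ('cV[K]_d -> K)),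
    (forall i, additive_fun (a i)) /\
    (forall x, f x = p.@[fun i => a i x]).
Proof.
move=> char0 _ tau_b OP_b.
have [m [b' [indep span']]] := lin_indep_spanning _ _ _ b.
rewrite span' => -[c fE].
(* An empty basis forces [f = 0]; the preceding results concern matrices of positive size. *)
case: m => [|m] in b' indep span' c fE *.
  exists 0%N, 0, (fun _ _ => 0); split=> [[]//|x].
  by rewrite fE big_ord0 meval0.
have b'_span i : in_span b' (b' i).
  exists (fun j => (j == i)%:R) => x; rewrite (bigD1 i) //= eqxx mul1r big1 ?addr0 //.
  by move=> j /negbTE->; rewrite mul0r.
have [||T [TE TD Tunip]] := @translation_mx _ _ _ b' char0 indep.
- by move=> h i; apply/span'/tau_b/span'.
- by move=> P i uP; apply/span'/OP_b => //; apply/span'.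
have /functional_choice[P PE] h := unipotent_expr_poly _ _ _ _ char0 (Tunip h).
have szP h i j : (size (P h i j) <= m.+2)%N by have [] := PE h.
have PT h k : map_mx (horner_eval k%:R) (P h) = T h ^+ k.
  by have [_ ->] := PE h; rewrite subrK.
pose A h := map_mx (coefp 1) (P h).
have AD h k : A (h + k) = A h + A k.
  apply: (polymx_coef1_mul _ _ _ _ _ _ _ char0 _ (PT h) (PT k)); last by rewrite -TD.
  by rewrite /GRing.comm -!TD addrC.
(* One variable for each entry of [A x]; [G] is the exponential of the generic matrix [X], truncated
   at the unipotency exponent [m.+2]. *)
pose s := (m.+1 * m.+1)%N.
pose X : 'M[{mpoly K[s]}]_m.+1 := \matrix_(i, j) 'X_(mxvec_index i j).
pose G : 'M[{mpoly K[s]}]_m.+1 := \sum_(r < m.+2) ((r`!%:R)^-1)%:MP *: X ^+ r.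
(* This encodes [f x] as the combination with weights [c i] of the entries of [T x] applied to the
   constant vector of the [b' j 0]. *)
pose p : {mpoly K[s]} := \sum_i (c i)%:MP * \sum_j G i j * (b' j 0)%:MP.
exists s, p, (fun i x => mxvec (A x) 0 i); split=> [i x y|x].
  by rewrite AD linearD mxE.
set v := fun i => _.
have XA : map_mx (meval v) X = A x.
  by apply/matrixP => i j; rewrite !mxE mevalXU /v mxvecE mxE.
have GT : map_mx (meval v) G = T x.
  rewrite (polymx_exp _ _ _ _ _ char0 (szP x) (PT x)) -/(A x).
  rewrite map_mx_sum; apply: eq_bigr => r _.
  by rewrite map_mxZ /= mevalC rmorphXn /= XA.
rewrite fE /p rmorph_sum /=; apply: eq_bigr => i _; rewrite mevalM mevalC; congr (_ * _).
have /colP/(_ i) := TE x 0; rewrite add0r !mxE => ->.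
rewrite rmorph_sum; apply: eq_bigr => j _.
by rewrite rmorphM /= mevalC mxE -GT mxE.
Qed.
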